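(* Let $B$ be a finite connected graph of positive order without half-loops. Let $\Psi$ be a finite collection of connected, pruned $B$-graphs, each of order at least one, and let $I_\Psi(G)$ be $1$ if $G$ has a subgraph isomorphic (as a $B$-graph) to an element of $\Psi$ and $0$ otherwise. Then for every positive integer $r$ there are constants $p_1,\dots,p_{r-1}$ such that $$\mathbb E_{G\in\mathcal C_n(B)}[I_\Psi(G)]=p_1n^{-1}+p_2n^{-2}+\cdots+p_{r-1}n^{1-r}+O(n^{-r}).$$
   Context: Graphs are finite, multiple edges and whole-loops allowed, no half-loops; $\mathrm{ord}(\psi)=|E_\psi|-|V_\psi|$ ($E$ undirected edges); pruned means every vertex has degree at least two. A $B$-graph is a graph with a morphism to $B$; graphs of $\mathcal C_n(B)$ are $B$-graphs via their covering map. $\mathcal C_n(B)$: random cover with vertex set $V_B\times[n]$ from independent uniform permutations $\sigma(e)\in S_n$, one per undirected edge ($\sigma(e^{-1})=\sigma(e)^{-1}$), the edge over $e$ with tail $(t(e),i)$ having head $(h(e),\sigma(e)i)$. *)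

(* Defs.v *)
From HB Require Import structures.
From mathcomp Require Import all_boot all_order all_algebra all_fingroup.
From mathcomp Require Import reals.
Set Implicit Arguments. Unset Strict Implicit. Unset Printing Implicit Defensive.
Import Order.TTheory GRing.Theory Num.Theory.

(* A finite graph (multiple edges and whole-loops allowed, no half-loops),
   given by its finite set of vertices [gV], its finite set of directed edges
   (darts) [gD], the tail map [tl] and the fixed-point-free involution [inv]
   (e |-> e^{-1}).  The head of d is tl (inv d).  Undirected edges are the
   orbits {d, inv d}; a whole-loop is a pair d <> inv d with tl d = tl (inv d). *)
Record graph := Graph {
  gV : finType;
  gD : finType;
  tl : gD -> gV;
  inv : gD -> gD;
  invK : involutive inv;
  inv_nofix : forall d, inv d != d }.

Definition hd (G : graph) (d : gD G) : gV G := tl (inv d).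

Definition nedges (G : graph) : nat := #|gD G|./2.

Definition graph_order (G : graph) : int := (nedges G)%:Z - (#|gV G|)%:Z.

Definition adj (G : graph) : rel (gV G) :=
  fun u v => [exists d : gD G, (tl d == u) && (hd d == v)].

Definition connected (G : graph) : bool :=
  (0 < #|gV G|) && [forall u : gV G, [forall v : gV G, connect (@adj G) u v]].

(* degree: number of darts with tail v (a whole-loop contributes 2) *)
Definition degree (G : graph) (v : gV G) : nat := #|[set d : gD G | tl d == v]|.

Definition pruned (G : graph) : bool := [forall v : gV G, 1 < degree v].

Definition is_morphism (G H : graph) (fV : gV G -> gV H) (fD : gD G -> gD H) : Prop :=
  (forall d, fV (tl d) = tl (fD d)) /\ (forall d, fD (inv d) = inv (fD d)).

Record bgraph (B : graph) := BGraph {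
  bg : graph;
  piV : gV bg -> gV B;
  piD : gD bg -> gD B;
  pi_morph : is_morphism piV piD }.

(* X embeds in Y as a B-graph: there is an injective B-graph morphism X -> Y,
   i.e. Y has a subgraph isomorphic (as a B-graph) to X. *)
Definition embeds (B : graph) (X Y : bgraph B) : bool :=
  [exists fV : {ffun gV (bg X) -> gV (bg Y)},
   [exists fD : {ffun gD (bg X) -> gD (bg Y)},
    [&& injectiveb fV, injectiveb fD,
        [forall d, fV (tl d) == tl (fD d)],
        [forall d, fD (inv d) == inv (fD d)],
        [forall v, piV (fV v) == piV v] &
        [forall d, piD (fD d) == piD d]]]].

(* The probability space of C_n(B): assignments of permutations to darts
   compatible with sigma(e^{-1}) = sigma(e)^{-1}; the uniform distribution on
   this set is the same as choosing one independent uniform permutation per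
   undirected edge. *)
Definition cover_space (B : graph) (n : nat) :=
  {s : {ffun gD B -> {perm 'I_n}} | [forall e, s (inv e) == (s e)^-1]%g}.

Section Cover.
Variables (B : graph) (n : nat) (s : cover_space B n).

Definition cover_tl (p : (gD B * 'I_n)%type) : (gV B * 'I_n)%type := (tl p.1, p.2).
Definition cover_inv (p : (gD B * 'I_n)%type) : (gD B * 'I_n)%type :=
  (inv p.1, (val s p.1) p.2).

Lemma cover_invK : involutive cover_inv.
Proof.
case=> e i; rewrite /cover_inv /= invK.
have /forallP /(_ e) /eqP -> := valP s.
by rewrite permK.
Qed.

Lemma cover_nofix p : cover_inv p != p.
Proof.
case: p => e i; rewrite /cover_inv /= xpair_eqE negb_and.
by rewrite inv_nofix.
Qed.

Definition cover_graph : graph :=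
  @Graph (gV B * 'I_n)%type (gD B * 'I_n)%type
         cover_tl cover_inv cover_invK cover_nofix.

Lemma cover_proj_morph : @is_morphism cover_graph B fst fst.
Proof. by split. Qed.

Definition cover : bgraph B := @BGraph B cover_graph fst fst cover_proj_morph.
End Cover.

Definition IPsi (B : graph) (m : nat) (Psi : 'I_m -> bgraph B) (G : bgraph B) : bool :=
  [exists i : 'I_m, embeds (Psi i) G].

Definition expect_IPsi (R : realType) (B : graph) (m : nat) (Psi : 'I_m -> bgraph B)
  (n : nat) : R :=
  ((\sum_(s : cover_space B n) ((IPsi Psi (cover s) : nat)%:R : R))
     / (#|{: cover_space B n}|%:R))%R.

(* Main.v *)
From Pilot Require Import Defs.
From mathcomp Require Import all_boot all_order all_algebra all_fingroup.
From mathcomp Require Import reals.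
From mathcomp Require Import zify ring lra.
(* [all_fingroup] shadows [inv]. *)
Import Pilot.Defs.
Set Implicit Arguments. Unset Strict Implicit. Unset Printing Implicit Defensive.
Import Order.TTheory GRing.Theory Num.Theory.
Local Open Scope ring_scope.

(** Let [G] be a random cover. By Moebius inversion the indicator that [G] contains a
    copy of some element of [Psi] is the sum, over the dart sets [W] of [G], of a
    coefficient that vanishes unless [W] is a union of copies and is invariant under
    relabelling the fibres. Gluing a new copy to a union of copies raises its order by at
    least one, so unions of order below [r] have boundedly many vertices. Keeping only
    these, the error is zero unless [G] contains a union of copies of order at least [r],
    and one such union can be chosen with boundedly many vertices; joining it to each
    small set bounds the error by a weighted count of bounded unions of order at least [r].

    The expected value of an invariant weighted count of bounded sets [W] is a finite sum
    of terms [c * 'C(n, a) * \prod_e 1 / n ^_ d_e], where [a] labels and [\sum_e d_e]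
    edges occur in [W]. Each expands in powers of [1/n], starting at exponent
    [\sum_e d_e - a], which is at least the order of [W]: hence at least [1] for the main
    part and at least [r] for the error. *)

(** * Asymptotic expansions in powers of [1/n] *)

Section Expansion.
Variable R : realFieldType.
Implicit Types (g h : nat -> R) (S T : {poly R}) (q r : nat).

(** The degree of [T] is not limited to [r], so sums and products of expansions need no truncation;
    [expands_truncate] cuts the tail off once at the end. *)
Definition expands r g T := exists (C : R) (N : nat),
  forall n, (N <= n)%N -> `|g n - T.[n%:R^-1]| <= C * n%:R^-1 ^+ r.

Lemma invn_ge0 n : 0 <= n%:R^-1 :> R.
Proof. by rewrite invr_ge0 ler0n. Qed.

Lemma invn_le1 n : n%:R^-1 <= 1 :> R.
Proof.
case: n => [|n]; first by rewrite invr0 ler01.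
by rewrite invf_le1 ?ltr0n // ler1n.
Qed.

Lemma horner_bounded T : exists2 C : R, 0 <= C & forall x, 0 <= x <= 1 -> `|T.[x]| <= C.
Proof.
exists (\sum_(i < size T) `|T`_i|); first by apply: sumr_ge0.
move=> x /andP[x0 x1]; rewrite horner_coef.
apply: le_trans (ler_norm_sum _ _ _) _; apply: ler_sum => i _.
rewrite normrM normrX (ger0_norm x0) -[leRHS]mulr1.
by apply: ler_wpM2l => //; apply: exprn_ile1.
Qed.

Lemma expands_ext r g h T : (exists N, forall n, (N <= n)%N -> g n = h n) ->
  expands r g T -> expands r h T.
Proof.
move=> [N1 eqgh] [C [N2 bnd]]; exists C, (maxn N1 N2) => n.
by rewrite geq_max => /andP[n1 n2]; rewrite -eqgh //; apply: bnd.
Qed.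

Lemma expands_horner r T : expands r (fun n => T.[n%:R^-1]) T.
Proof. by exists 0, 0%N => n _; rewrite subrr normr0 mul0r. Qed.

Lemma expandsD r g h S T :
  expands r g S -> expands r h T -> expands r (fun n => g n + h n) (S + T).
Proof.
move=> [C1 [N1 b1]] [C2 [N2 b2]]; exists (C1 + C2), (maxn N1 N2) => n.
rewrite geq_max => /andP[n1 n2]; rewrite hornerD mulrDl opprD addrACA.
by apply: le_trans (ler_normD _ _) _; apply: lerD; [apply: b1|apply: b2].
Qed.

Lemma expandsM r g h S T :
  expands r g S -> expands r h T -> expands r (fun n => g n * h n) (S * T).
Proof.
move=> [C1 [N1 b1]] [C2 [N2 b2]].
have [D1 D10 d1] := horner_bounded S; have [D2 D20 d2] := horner_bounded T.
(* [C1] and [C2] may be negative, hence the absolute values; [D1] and [D2] bound the two polynomials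
   on the unit interval. *)
exists ((`|C1| + D1) * `|C2| + D2 * `|C1|), (maxn N1 N2) => n.
rewrite geq_max => /andP[n1 n2]; rewrite hornerM.
have x01 : 0 <= (n%:R^-1 : R) <= 1 by rewrite invn_ge0 invn_le1.
move: (b1 _ n1) (b2 _ n2) (d1 _ x01) (d2 _ x01).
set s := S.[_]; set t := T.[_]; set y : R := _ ^+ r => e1 e2 e3 e4.
have y0 : 0 <= y by rewrite exprn_ge0 ?invn_ge0.
have y1 : y <= 1 by rewrite exprn_ile1 ?invn_ge0 ?invn_le1.
have f1 : `|g n - s| <= `|C1| * y.
  by apply: le_trans e1 _; apply: ler_wpM2r => //; apply: ler_norm.
have f2 : `|h n - t| <= `|C2| * y.
  by apply: le_trans e2 _; apply: ler_wpM2r => //; apply: ler_norm.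
have gn : `|g n| <= `|C1| + D1.
  rewrite -[g n](subrK s); apply: le_trans (ler_normD _ _) _; apply: lerD => //.
  by apply: le_trans f1 _; rewrite -[leRHS]mulr1; apply: ler_wpM2l.
have -> : g n * h n - s * t = g n * (h n - t) + t * (g n - s) by ring.
apply: le_trans (ler_normD _ _) _; rewrite mulrDl !normrM -!mulrA.
by apply: lerD; apply: ler_pM.
Qed.

Lemma expands_sum r (I : Type) (s : seq I) (P : pred I) (g : I -> nat -> R)
  (T : I -> {poly R}) :
  (forall i, P i -> expands r (g i) (T i)) ->
  expands r (fun n => \sum_(i <- s | P i) g i n) (\sum_(i <- s | P i) T i).
Proof.
move=> gT; elim: s => [|i s IH].
  rewrite big_nil; apply: expands_ext (expands_horner r 0).
  by exists 0%N => n _; rewrite big_nil horner0.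
rewrite big_cons; case: ifP => Pi.
  apply: expands_ext (expandsD (gT i Pi) IH).
  by exists 0%N => n _; rewrite big_cons Pi.
by apply: expands_ext IH; exists 0%N => n _; rewrite big_cons Pi.
Qed.

Lemma expands_prod r (I : Type) (s : seq I) (P : pred I) (g : I -> nat -> R)
  (T : I -> {poly R}) :
  (forall i, P i -> expands r (g i) (T i)) ->
  expands r (fun n => \prod_(i <- s | P i) g i n) (\prod_(i <- s | P i) T i).
Proof.
move=> gT; elim: s => [|i s IH].
  rewrite big_nil; apply: expands_ext (expands_horner r 1).
  by exists 0%N => n _; rewrite big_nil hornerC.
rewrite big_cons; case: ifP => Pi.
  apply: expands_ext (expandsM (gT i Pi) IH).
  by exists 0%N => n _; rewrite big_cons Pi.
by apply: expands_ext IH; exists 0%N => n _; rewrite big_cons Pi.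
Qed.

Lemma expands_geometric r (j : nat) :
  expands r (fun n => (1 - j%:R * n%:R^-1)^-1) (\sum_(k < r) (j%:R ^+ k) *: 'X^k).
Proof.
(* For [n > 2j] the ratio [z = j/n] is at most [1/2], so the geometric tail [z^r / (1 - z)] is at
   most [2 z^r]. *)
exists (2 * j%:R ^+ r), (j.*2.+1) => n jn.
rewrite horner_sum; under eq_bigr do rewrite hornerZ hornerXn -exprMn.
have n0 : 0 < n%:R :> R by rewrite ltr0n; lia.
set x : R := n%:R^-1; rewrite -mulrA -exprMn; set z := j%:R * x.
have z0 : 0 <= z by rewrite mulr_ge0 ?ler0n ?invn_ge0.
have z2 : z <= 2^-1.
  rewrite /z /x ler_pdivrMr // mulrC ler_pdivlMr ?ltr0n // -natrM ler_nat; lia.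
have u0 : 0 < 1 - z by lra.
have -> : (1 - z)^-1 - \sum_(i < r) z ^+ i = (1 - z)^-1 * z ^+ r.
  have e : 1 - z ^+ r = (1 - z) * \sum_(i < r) z ^+ i.
    by rewrite -[LHS]opprB subrX1 -mulNr opprB.
  have -> : z ^+ r = 1 - (1 - z) * \sum_(i < r) z ^+ i by rewrite -e subKr.
  by rewrite mulrBr mulr1 mulKf ?gt_eqF.
rewrite normrM ger0_norm ?invr_ge0 ?(ltW u0) // normrX (ger0_norm z0).
apply: ler_wpM2r; first exact: exprn_ge0.
by rewrite -[leRHS]invrK lef_pV2 ?posrE //; lra.
Qed.

Lemma ffactr_prod n k : (0 < n)%N -> (k <= n)%N ->
  (n ^_ k)%:R = n%:R ^+ k * \prod_(j < k) (1 - j%:R * n%:R^-1) :> R.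
Proof.
move=> n0; elim: k => [|k IH] kn; first by rewrite big_ord0 mulr1 ffactn0.
rewrite ffactnSr natrM IH ?(ltnW kn) // big_ord_recr /= exprSr natrB ?(ltnW kn) //.
field; rewrite pnatr_eq0; lia.
Qed.

Lemma expands_ffact r k : exists T,
  expands r (fun n => (n ^_ k)%:R / n%:R ^+ k) T.
Proof.
eexists; apply: expands_ext (expands_prod (index_enum 'I_k) (P := xpredT)
  (fun j _ => expands_horner r (1 - (nat_of_ord j)%:R *: 'X))).
exists k.+1 => n kn; have n0 : n%:R != 0 :> R by rewrite pnatr_eq0; lia.
rewrite ffactr_prod ?(leq_trans _ kn) // ?(ltnW kn) // mulrC mulKf ?expf_neq0 //.
by apply: eq_bigr => j _; rewrite !hornerE.
Qed.

Lemma expands_inv_ffact r k : exists T,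
  expands r (fun n => n%:R ^+ k / (n ^_ k)%:R) T.
Proof.
eexists; apply: expands_ext (expands_prod (index_enum 'I_k) (P := xpredT)
  (fun j _ => expands_geometric r (nat_of_ord j))).
exists k.+1 => n kn; have n0 : n%:R != 0 :> R by rewrite pnatr_eq0; lia.
rewrite ffactr_prod ?(leq_trans _ kn) // ?(ltnW kn) //.
by rewrite invfM mulrA mulfV ?expf_neq0 // mul1r prodfV.
Qed.

(** After dividing each falling factorial by its leading power of [n], all factors expand, and the
    remaining power is [n^(k - sum d)], whose exponent is at most [-q]. *)
Lemma expands_binomial_ratio r q k (I : finType) (P : pred I) (d : I -> nat) :
  (q + k <= \sum_(i | P i) d i)%N -> exists T,
  expands r (fun n => 'C(n, k)%:R * \prod_(i | P i) (n ^_ (d i))%:R^-1) ('X^q * T).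
Proof.
move=> qk; have [T0 e0] := expands_ffact r k.
have [T eT] : exists T, expands r
    (fun n => \prod_(i | P i) (n%:R ^+ d i / (n ^_ (d i))%:R)) T.
  have [T0' eT] : exists T' : I -> {poly R}, forall i,
      expands r (fun n => n%:R ^+ d i / (n ^_ (d i))%:R) (T' i).
    exact: (fin_all_exists (fun i => expands_inv_ffact r (d i))).
  by eexists; apply: expands_prod => i _; apply: eT.
(* The surplus of the decay exponent [sum d - k] over the guaranteed [q]. *)
pose s := (\sum_(i | P i) d i - k - q)%N.
pose U := k`!%:R^-1%:P * T0 * T.
exists ('X^s * U); rewrite (mulrA 'X^q 'X^s U) -exprD.
have /expandsM/(_ eT) := expandsM (expands_horner r (k`!%:R^-1%:P)) e0.
move/(expandsM (expands_horner r 'X^(q + s))).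
apply: expands_ext; exists k.+1 => n kn.
have n0 : n%:R != 0 :> R by rewrite pnatr_eq0; lia.
rewrite hornerXn hornerC big_split /=.
rewrite (_ : \prod_(i | P i) n%:R ^+ d i = n%:R ^+ (q + s + k)); last first.
  by rewrite prodrXr; congr (_ ^+ _); rewrite /s; lia.
rewrite -bin_ffact natrM exprVn [_ ^+ (q + s + k)]exprD.
have kf : k`!%:R != 0 :> R by rewrite pnatr_eq0 -lt0n fact_gt0.
set Q := \prod_(i | _) _; field.
by rewrite kf !expf_neq0.
Qed.

(** The factor ['X^q] kills the coefficients below [q], so the sum can start there. For [q >= r] the
    sum is empty and a pure [O(n^-r)] bound remains, the form used for the error term. *)
Lemma expands_truncate r q g T : expands r g ('X^q * T) ->
  exists (p : nat -> R) (C : R) (N : nat), forall n, (N <= n)%N ->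
    `|g n - \sum_(q <= k < r) p k / n%:R ^+ k| <= C / n%:R ^+ r.
Proof.
set S := 'X^q * T => -[C [N b]].
have [D D0 d] := horner_bounded (drop_poly r S).
exists (fun k => S`_k), (C + D), N => n nN.
set x : R := n%:R^-1.
have x01 : 0 <= x <= 1 by rewrite invn_ge0 invn_le1.
have -> : \sum_(q <= k < r) S`_k / n%:R ^+ k = (take_poly r S).[x].
  rewrite (horner_coef_wide _ (size_take_poly r S)).
  rewrite -(big_mkord xpredT (fun k => (take_poly r S)`_k * x ^+ k)).
  have Sq k : (k < q)%N -> S`_k = 0 by move=> kq; rewrite coefXnM kq.
  have [qr|rq] := leqP q r; last first.
    rewrite [LHS]big_geq ?(ltnW rq) // big_nat big1 // => k /andP[_ kr].
    by rewrite coef_take_poly kr Sq ?mul0r //; apply: ltn_trans rq.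
  have z : \sum_(0 <= k < q) (take_poly r S)`_k * x ^+ k = 0.
    rewrite big_nat big1 // => k /andP[_ kq].
    by rewrite coef_take_poly Sq // if_same mul0r.
  rewrite [RHS](big_cat_nat (leq0n q) qr) /= z add0r.
  by apply: eq_big_nat => k /andP[_ kr]; rewrite coef_take_poly kr exprVn.
have e : S.[x] = (take_poly r S).[x] + (drop_poly r S).[x] * x ^+ r.
  by rewrite -{1}(poly_take_drop r S) hornerD hornerM hornerXn.
rewrite -exprVn -/x mulrDl.
have -> : g n - (take_poly r S).[x] = (g n - S.[x]) + (drop_poly r S).[x] * x ^+ r.
  by rewrite e; ring.
apply: le_trans (ler_normD _ _) _; apply: lerD; first exact: b.
have xr : 0 <= x ^+ r by rewrite exprn_ge0 ?invn_ge0.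
by rewrite normrM (ger0_norm xr) ler_wpM2r ?d.
Qed.

End Expansion.

(** * Moebius inversion over the subsets of a finite set *)

Section Moebius.
Variables (R : realFieldType) (T : finType).
Implicit Types (A U W : {set T}) (t : T).

Definition toggle t U := if t \in U then U :\ t else t |: U.

Lemma toggleK t : involutive (toggle t).
Proof.
move=> U; rewrite /toggle; case tU: (t \in U).
  by rewrite setD11 setD1K.
by rewrite setU11 setU1K ?tU.
Qed.

Lemma sign_toggle t U : (-1) ^+ #|toggle t U| = - (-1) ^+ #|U| :> R.
Proof.
rewrite /toggle; case: ifP => tU.
  by rewrite (cardsD1 t U) tU add1n exprS mulN1r opprK.
by rewrite cardsU1 tU add1n exprS mulN1r.
Qed.

(** Toggling [t] is a sign-reversing involution of the index set, so the sum equals its own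
    negative. *)
Lemma sum_toggle0 t (P : pred {set T}) (F : {set T} -> R) :
  (forall U, P (toggle t U) = P U) -> (forall U, P U -> F (toggle t U) = - F U) ->
  \sum_(U | P U) F U = 0.
Proof.
move=> tP tF; set s := LHS.
have : s = - s.
  rewrite {1}/s (reindex_inj (inv_inj (toggleK t))) /= (eq_bigl P) //.
  by rewrite -sumrN; apply: eq_bigr => U /tF.
by move=> e; lra.
Qed.

(** The exponent has the parity of the size of [W] minus [U]; adding the cardinals avoids a
    truncated subtraction. *)
Definition moebius (h : {set T} -> R) W :=
  \sum_(U : {set T} | U \subset W) (-1) ^+ (#|W| + #|U|) * h U.

Lemma sub_toggle t U W : t \in W -> (toggle t U \subset W) = (U \subset W).
Proof.
move=> tW; rewrite /toggle; case: ifP => tU; last by rewrite subUset sub1set tW.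
by rewrite -{2}(setD1K tU) subUset sub1set tW.
Qed.

Lemma toggle_super t U W : t \notin U -> (U \subset toggle t W) = (U \subset W).
Proof.
move=> tU; rewrite /toggle; case: ifP => tW; first by rewrite subsetD1 tU andbT.
apply/subsetP/subsetP => sub x xU; last by rewrite in_setU1 sub ?orbT.
by move: (sub x xU); rewrite in_setU1; case: eqP => // xt; rewrite -xt xU in tU.
Qed.

(** After exchanging the sums, the coefficient of [h U] is an alternating sum over the sets between
    [U] and [A]; toggling an element of [A] outside [U] cancels it unless [U = A]. *)
Lemma moebius_inversion h A : \sum_(W : {set T} | W \subset A) moebius h W = h A.
Proof.
rewrite /moebius (exchange_big_dep (fun U : {set T} => U \subset A)) /=; last first.
  by move=> W U WA UW; apply: subset_trans UW WA.
rewrite (bigD1 A) //= [X in _ + X]big1 ?addr0.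
  rewrite (eq_bigl (pred1 A)); last by move=> W; rewrite /= -eqEsubset.
  by rewrite big_pred1_eq addnn -mul2n exprM sqrrN !expr1n mul1r.
move=> U /andP[UA neq]; rewrite -mulr_suml.
have /subsetPn[t tA tU] : ~~ (A \subset U).
  by apply: contra neq => AU; rewrite eqEsubset UA.
rewrite (sum_toggle0 (t := t)) ?mul0r // => W.
  by rewrite sub_toggle // toggle_super.
by rewrite !exprD sign_toggle mulNr.
Qed.

(** Subsets of [W] with and without [t] cancel in pairs. This later confines the inversion to unions
    of copies. *)
Lemma moebius_eq0 h W t : t \in W ->
  (forall U, U \subset W -> h (toggle t U) = h U) -> moebius h W = 0.
Proof.
move=> tW ht; apply: (sum_toggle0 (t := t)) => [U|U UW]; first exact: sub_toggle.
by rewrite !exprD sign_toggle ht // mulrN mulNr.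
Qed.

Lemma moebius_bound h W : (forall U, `|h U| <= 1) -> `|moebius h W| <= 2 ^+ #|W|.
Proof.
move=> h1; apply: le_trans (ler_norm_sum _ _ _) _.
apply: le_trans (ler_sum (G := fun=> 1) _ _) _.
  by move=> U _; rewrite normrM normrX normrN normr1 expr1n mul1r.
rewrite sumr_const -natrX ler_nat -card_powerset; apply: subset_leq_card.
by apply/subsetP => U; rewrite inE.
Qed.

End Moebius.

(** * Transport of sets and Moebius coefficients along injections *)

Section ImsetPreimset.
Variables (T T' : finType) (f : T -> T').

Lemma preimset_imset (A : {set T}) : injective f -> f @^-1: (f @: A) = A.
Proof. by move=> inj; apply/setP => x; rewrite inE mem_imset. Qed.

Lemma imset_preimset (A : {set T'}) : A \subset codom f -> f @: (f @^-1: A) = A.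
Proof.
move=> /subsetP sub; apply/setP => y; apply/imsetP/idP => [[x + ->]|yA]; first by rewrite inE.
by have /codomP[x yx] := sub y yA; exists x => //; rewrite inE -yx.
Qed.

Lemma imset_sub_codom (A : {set T}) : f @: A \subset codom f.
Proof. by apply/subsetP => _ /imsetP[x _ ->]; apply: codom_f. Qed.

Lemma imset_inj_sub (A C : {set T}) : injective f -> (f @: A \subset f @: C) = (A \subset C).
Proof. by move=> inj; rewrite sub_imset_pre preimset_imset. Qed.

End ImsetPreimset.

Lemma moebius_imset (R : realFieldType) (T T' : finType) (f : T -> T') (h : {set T} -> R)
  (h' : {set T'} -> R) (W : {set T}) : injective f ->
  (forall U : {set T}, h' (f @: U) = h U) -> moebius h' (f @: W) = moebius h W.
Proof.
move=> inj hh; rewrite /moebius.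
rewrite (reindex_onto (fun U : {set T} => f @: U) (fun U : {set T'} => f @^-1: U)) /=.
  apply: eq_big => [U|U _]; last by rewrite hh !card_imset.
  by rewrite preimset_imset // eqxx andbT imset_inj_sub.
by move=> U UW; apply: imset_preimset; apply: subset_trans UW (imset_sub_codom _ _).
Qed.

(** * Counting the permutations that extend a partial injection *)

Section PartialPermutations.
Variable n : nat.
Implicit Types (P : {set 'I_n * 'I_n}) (s : {perm 'I_n}).

Definition graph_sub P s := [forall p in P, s p.1 == p.2].

(** The boolean equality states at once that [P] is single-valued and that it is injective. *)
Definition partial_inj k (P : {set 'I_k * 'I_k}) :=
  [forall p in P, forall q in P, (p.1 == q.1) == (p.2 == q.2)].

Lemma partial_injP k (P : {set 'I_k * 'I_k}) :
  reflect {in P &, forall p q, (p.1 == q.1) = (p.2 == q.2)} (partial_inj P).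
Proof.
apply: (iffP forall_inP) => [H p q pP qP|H p pP].
  by have /forall_inP/(_ q qP)/eqP := H p pP.
by apply/forall_inP => q qP; apply/eqP/H.
Qed.

Lemma graph_sub_inj P s : graph_sub P s -> partial_inj P.
Proof.
move=> /forall_inP H; apply/partial_injP => p q pP qP.
by rewrite -(eqP (H p pP)) -(eqP (H q qP)) (inj_eq perm_inj).
Qed.

(* The induction step sends [p.1] to [p.2] by composing with a transposition
   that moves no value already prescribed. *)
Lemma partial_inj_extend P : partial_inj P -> exists s, graph_sub P s.
Proof.
have [k] := ubnP #|P|; elim: k P => // k IH P Pk inj.
have [->|[p pP]] := set_0Vmem P.
  by exists 1%g; apply/forall_inP => p; rewrite inE.
have /partial_injP inj' := inj.
have [||s /forall_inP sP] := IH (P :\ p).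
- by rewrite (cardsD1 p) pP in Pk.
- by apply/partial_injP => q q' /setD1P[_ qP] /setD1P[_ q'P]; apply: inj'.
exists (s * tperm (s p.1) p.2)%g; apply/forall_inP => q qP; rewrite permM.
have [->|qp] := eqVneq q p; first by rewrite tpermL.
have /sP/eqP sq : q \in P :\ p by rewrite !inE qp.
have q2 : p.2 != q.2.
  apply: contra qp => /eqP e; move: (inj' q p qP pP).
  by rewrite e eqxx => /eqP e1; rewrite -pair_eqE /= e1 e !eqxx.
rewrite sq tpermD // -sq (inj_eq perm_inj) eq_sym.
by rewrite inj' // eq_sym.
Qed.

(** The extensions of [P] form a coset: one extension [s0] followed by any permutation fixing the
    image [D] of [P] pointwise. *)
Lemma card_graph_sub P : partial_inj P -> #|[set s | graph_sub P s]| = (n - #|P|)`!.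
Proof.
move=> inj; have [s0 s0P] := partial_inj_extend inj.
have inj2 : {in P &, injective snd}.
  move=> p q pP qP /= e; have /partial_injP/(_ p q pP qP) := inj.
  by rewrite e eqxx => /eqP e1; case: p q e e1 {pP qP} => ? ? [? ?] /= -> ->.
pose D := [set p.2 | p in P].
have -> : [set s | graph_sub P s] = [set (s0 * u)%g | u in perm_on (~: D)].
  apply/setP => s; rewrite inE; apply/idP/imsetP => [/forall_inP sP|[u uD ->]].
    exists (s0^-1 * s)%g; last by rewrite mulKVg.
    apply/subsetP => j; rewrite !inE; apply: contra => /imsetP[p pP ->].
    by rewrite permM -(eqP (forall_inP s0P p pP)) permK (eqP (sP p pP))
      (eqP (forall_inP s0P p pP)).
  apply/forall_inP => p pP; rewrite permM (eqP (forall_inP s0P p pP)).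
  by apply/eqP/(out_perm uD); rewrite !inE negbK; apply: imset_f.
rewrite card_imset; last exact: mulgI.
by rewrite card_perm cardsCs setCK card_ord card_in_imset.
Qed.

End PartialPermutations.

(** * Dart sets in the complete cover and their containment probability *)

Section Triples.
Variable B : graph.

(* The darts of the complete n-fold cover: [(e, (i, j))] is a potential dart
   over [e] from the [i]-th to the [j]-th vertex of the fibres. *)
Definition tri n := (gD B * ('I_n * 'I_n))%type.
Definition tail n (t : tri n) : gV B * 'I_n := (tl t.1, t.2.1).
Definition trev n (t : tri n) : tri n := (inv t.1, (t.2.2, t.2.1)).
Definition relabel k n (f : 'I_k -> 'I_n) (t : tri k) : tri n := (t.1, (f t.2.1, f t.2.2)).

Definition verts n (W : {set tri n}) := [set tail t | t in W].
Definition labels n (W : {set tri n}) := [set t.2.1 | t in W] :|: [set t.2.2 | t in W].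
Definition symset n (W : {set tri n}) := [forall t in W, trev t \in W].
(** The set of values that [W] prescribes for the permutation over [e]. *)
Definition fibre n (W : {set tri n}) e : {set 'I_n * 'I_n} := [set p | (e, p) \in W].

(** An orientation of [B]: since [inv] has no fixed point, exactly one dart of each undirected edge
    is positive. *)
Definition positive (e : gD B) := (enum_rank e < enum_rank (inv e))%N.

Lemma positive_inv e : positive (inv e) = ~~ positive e.
Proof.
rewrite /positive invK -leqNgt ltn_neqAle.
by rewrite (inj_eq (@ord_inj _)) (inj_eq enum_rank_inj) (negbTE (inv_nofix e)).
Qed.

Lemma trevK n : involutive (@trev n).
Proof. by case=> e [i j]; rewrite /trev /= invK. Qed.

Lemma symsetP n (W : {set tri n}) :
  reflect (forall t, t \in W -> trev t \in W) (symset W).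
Proof. exact: forall_inP. Qed.

Lemma symset_trev n (W : {set tri n}) t : symset W -> (trev t \in W) = (t \in W).
Proof. by move=> /symsetP H; apply/idP/idP => /H //; rewrite trevK. Qed.

Lemma symsetD n (U W : {set tri n}) : symset U -> symset W -> symset (U :\: W).
Proof.
by move=> sU sW; apply/symsetP => t; rewrite !inE !symset_trev.
Qed.

Lemma card_fibre_inv n (W : {set tri n}) e : symset W -> #|fibre W (inv e)| = #|fibre W e|.
Proof.
move=> sW; have swK : involutive (fun p : 'I_n * 'I_n => (p.2, p.1)) by case.
rewrite -(card_imset _ (inv_inj swK)); apply: eq_card => p.
rewrite -{1}[p]swK mem_imset ?inE; last exact: inv_inj.
by rewrite -symset_trev // /trev /= invK; case: p.
Qed.

Lemma card_fibres n (W : {set tri n}) : #|W| = \sum_e #|fibre W e|.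
Proof.
rewrite -sum1_card (partition_big (fun t => t.1) xpredT) //=.
apply: eq_bigr => e _; rewrite -sum1_card.
rewrite (reindex_onto (fun p => (e, p)) (fun t => t.2)) /=.
  by apply: eq_bigl => p; rewrite !inE !eqxx !andbT.
by move=> [e' p] /= /andP[_ /eqP ->].
Qed.

Lemma card_symset n (W : {set tri n}) : symset W ->
  #|W| = (\sum_(e | positive e) #|fibre W e|).*2.
Proof.
move=> sW; rewrite card_fibres (bigID positive) /= -addnn; congr (_ + _)%N.
rewrite (reindex_inj (inv_inj (@invK B))) /=.
by apply: eq_big => [e|e _]; rewrite ?card_fibre_inv // positive_inv negbK.
Qed.

Lemma relabel_inj k n (f : 'I_k -> 'I_n) : injective f -> injective (relabel f).
Proof. by move=> inj [e [i j]] [e' [i' j']] [-> /inj -> /inj ->]. Qed.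

Lemma relabel_trev k n (f : 'I_k -> 'I_n) t : relabel f (trev t) = trev (relabel f t).
Proof. by []. Qed.

Lemma symset_relabel k n (f : 'I_k -> 'I_n) (W : {set tri k}) :
  injective f -> symset (relabel f @: W) = symset W.
Proof.
move=> /relabel_inj inj; apply/symsetP/symsetP => H t.
  by rewrite -(mem_imset _ _ inj) => /H; rewrite -relabel_trev mem_imset.
by move=> /imsetP[u uW ->]; rewrite -relabel_trev mem_imset // H.
Qed.

Lemma fibre_relabel k n (f : 'I_k -> 'I_n) (W : {set tri k}) e :
  fibre (relabel f @: W) e = [set (f p.1, f p.2) | p in fibre W e].
Proof.
apply/setP => p; rewrite inE; apply/imsetP/imsetP => [[[e' q] qW [-> ->]]|[q qW ->]].
  by exists q => //; rewrite inE.
by exists (e, q) => //; rewrite inE in qW.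
Qed.

Lemma pair_inj k n (f : 'I_k -> 'I_n) : injective f ->
  injective (fun p : 'I_k * 'I_k => (f p.1, f p.2)).
Proof. by move=> inj [i j] [i' j'] [/inj -> /inj ->]. Qed.

Lemma card_fibre_relabel k n (f : 'I_k -> 'I_n) (W : {set tri k}) e : injective f ->
  #|fibre (relabel f @: W) e| = #|fibre W e|.
Proof. by move=> inj; rewrite fibre_relabel card_imset //; apply: pair_inj. Qed.

Lemma partial_inj_relabel k n (f : 'I_k -> 'I_n) (W : {set tri k}) e : injective f ->
  partial_inj (fibre (relabel f @: W) e) = partial_inj (fibre W e).
Proof.
move=> inj; rewrite fibre_relabel; apply/partial_injP/partial_injP => H p q.
  move=> pW qW; rewrite -!(inj_eq inj).
  exact: (H (f p.1, f p.2) (f q.1, f q.2) (imset_f _ pW) (imset_f _ qW)).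
by move=> /imsetP[p' pW ->] /imsetP[q' qW ->] /=; rewrite !(inj_eq inj) H.
Qed.

(** The dart [(e, i)] of the cover is identified with the triple that also records the index of its
    head, so all covers live in one ambient set. *)
Definition cover_darts n (s : cover_space B n) : {set tri n} :=
  [set t | val s t.1 t.2.1 == t.2.2].

(** A point of the cover space amounts to a free choice of one permutation per positive dart. By
    symmetry of [W], the constraint over [inv e] repeats the one over [e], so the constraints are
    independent. *)
Lemma card_cover_sub n (W : {set tri n}) : symset W ->
  #|[set s : cover_space B n | W \subset cover_darts s]| =
  (\prod_(e | positive e) #|[set s | graph_sub (fibre W e) s]|)%N.
Proof.
move=> sW; pose F e : pred {perm 'I_n} := [pred s | graph_sub (fibre W e) s].
(* Families defined on all darts but trivial off the positive ones represent these free choices. *)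
transitivity #|pfamily (1%g : {perm 'I_n}) positive F|; last first.
  rewrite card_pfamily foldrE big_map big_enum /=.
  by apply: eq_bigr => e _; apply: eq_card => s; rewrite !inE.
pose restr (s : cover_space B n) := [ffun e => if positive e then val s e else 1%g].
have sinv (s : cover_space B n) e : val s (inv e) = ((val s e)^-1)%g.
  by have /forallP/(_ e)/eqP := valP s.
have restr_inj : injective restr.
  move=> s s' /ffunP E; apply/val_inj/ffunP => e.
  have [pe|] := boolP (positive e); first by move: (E e); rewrite !ffunE pe.
  rewrite -positive_inv => pe; apply: invg_inj; rewrite -!sinv.
  by move: (E (inv e)); rewrite !ffunE pe.
rewrite -(card_imset _ restr_inj); apply: eq_card => u.
apply/imsetP/pfamilyP => [[s sWs ->]|[supp uF]].
  move: sWs; rewrite inE => /subsetP sub; split.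
    by apply/subsetP => e; rewrite !inE ffunE; case: ifP => //; rewrite eqxx.
  move=> e pe; have pe1 : positive e := pe; rewrite ffunE pe1 inE.
  by apply/forall_inP => p; rewrite inE => /sub; rewrite inE.
pose v := [ffun e => if positive e then u e else ((u (inv e))^-1)%g].
have vP : [forall e, v (inv e) == (v e)^-1]%g.
  apply/forallP => e; rewrite !ffunE positive_inv invK.
  by case: (positive e); rewrite /= ?invgK.
exists (exist _ v vP : cover_space B n).
  rewrite inE; apply/subsetP => -[e [i j]] tW; rewrite inE /= ffunE.
  case: ifP => pe.
    by have /forall_inP/(_ (i, j)) := uF e pe; rewrite inE => /(_ tW).
  have pe' : positive (inv e) by rewrite positive_inv pe.
  have /forall_inP/(_ (j, i)) := uF _ pe'; rewrite inE /=.
  have -> : (inv e, (j, i)) \in W by rewrite (symset_trev (e, (i, j))).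
  by move=> /(_ isT)/eqP <-; rewrite permK.
apply/ffunP => e; rewrite !ffunE; case pe: (positive e) => //.
apply/eqP/idPn => ue; have /subsetP/(_ e) := supp.
by rewrite !inE ue => /(_ isT); rewrite -topredE /= pe.
Qed.

Section Probability.
Variable R : realFieldType.

Definition prob_sub n (W : {set tri n}) : R :=
  #|[set s : cover_space B n | W \subset cover_darts s]|%:R / #|{: cover_space B n}|%:R.

(** Here [W] lives on a fixed label set ['I_k] while [n] varies, which isolates the dependence on
    [n]. *)
Definition prob_formula k (W : {set tri k}) n : R :=
  if [forall e, positive e ==> partial_inj (fibre W e)] then
    \prod_(e | positive e) (n ^_ #|fibre W e|)%:R^-1 else 0.

Lemma card_partial_inj k (P : {set 'I_k * 'I_k}) : partial_inj P -> (#|P| <= k)%N.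
Proof.
move=> /partial_injP inj; rewrite -(card_in_imset (f := fst)); last first.
  move=> [i j] [i' j'] pP qP /= e; move: (inj _ _ pP qP); rewrite e eqxx /=.
  by move=> /esym/eqP ->.
by rewrite -[k in (_ <= k)%N]card_ord max_card.
Qed.

(** Each positive dart contributes [(n - d)! / n!], the inverse of a falling factorial, where [d] is
    the size of the fibre. *)
Lemma prob_relabel k n (f : 'I_k -> 'I_n) (W : {set tri k}) : injective f -> symset W ->
  prob_sub (relabel f @: W) = prob_formula W n.
Proof.
move=> inj sW; rewrite /prob_sub /prob_formula card_cover_sub ?symset_relabel //.
(* The whole space is counted as the covers that contain the empty set. *)
have -> : #|{: cover_space B n}| = (\prod_(e | positive e) n`!)%N.
  transitivity #|[set s : cover_space B n | (set0 : {set tri n}) \subset cover_darts s]|.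
    by rewrite -cardsT; apply: eq_card => s; rewrite !inE sub0set.
  rewrite card_cover_sub; last by apply/symsetP => t; rewrite inE.
  apply: eq_bigr => e _; rewrite (_ : fibre _ _ = set0); last first.
    by apply/setP => p; rewrite !inE.
  rewrite card_graph_sub ?cards0 ?subn0 //.
  by apply/partial_injP => p q; rewrite inE.
(* A fibre that is not a partial injection lies in no permutation, so its factor vanishes. *)
case: ifP => [/forallP H|/negbT]; last first.
  rewrite negb_forall => /existsP[e]; rewrite negb_imply => /andP[pe ninj].
  rewrite (bigD1 e) //= (_ : #|_| = 0%N) ?mul0n ?mul0r //.
  apply/eqP; rewrite cards_eq0 -subset0; apply/subsetP => s; rewrite !inE.
  by move/graph_sub_inj; rewrite partial_inj_relabel // (negbTE ninj).
rewrite !natr_prod -prodf_div; apply: eq_bigr => e pe.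
have inje := implyP (H e) pe.
have kn : (#|fibre W e| <= n)%N.
  by rewrite -(card_fibre_relabel _ _ inj) card_partial_inj ?partial_inj_relabel.
rewrite card_graph_sub ?partial_inj_relabel // card_fibre_relabel //.
rewrite -(ffact_fact kn) natrM invfM mulrCA mulfV ?mulr1 //.
by rewrite pnatr_eq0 -lt0n fact_gt0.
Qed.

End Probability.
End Triples.

(** * Expansion of relabelling-invariant weighted counts *)

Section InvariantSums.
Variables (R : realFieldType) (B : graph).
Notation tri := (tri B).

Definition expandable q r (g : nat -> R) := exists T, expands r g ('X^q * T).

Lemma expandable_ext q r g h : g =1 h -> expandable q r g -> expandable q r h.
Proof. by move=> gh [T eT]; exists T; apply: expands_ext eT; exists 0%N. Qed.

Lemma expandable0 q r : expandable q r (fun=> 0).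
Proof.
exists 0; rewrite mulr0; apply: expands_ext (expands_horner r 0).
by exists 0%N => n _; rewrite horner0.
Qed.

Lemma expandableZ q r c g : expandable q r g -> expandable q r (fun n => c * g n).
Proof.
move=> [T eT]; exists (c%:P * T); rewrite mulrCA.
apply: expands_ext (expandsM (expands_horner r c%:P) eT).
by exists 0%N => n _; rewrite hornerC.
Qed.

Lemma expandable_sum q r (I : finType) (P : pred I) (g : I -> nat -> R) :
  (forall i, P i -> expandable q r (g i)) ->
  expandable q r (fun n => \sum_(i | P i) g i n).
Proof.
move=> H; have [T eT] : exists T : I -> {poly R}, forall i,
    P i -> expands r (g i) ('X^q * T i).
  apply: (fin_all_exists (P := fun i T => P i -> expands r (g i) ('X^q * T))) => i.
  by case Pi: (P i); [have [T eT] := H i Pi; exists T|exists 0].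
exists (\sum_(i | P i) T i); rewrite mulr_sumr; exact: expands_sum.
Qed.

Lemma labels_relabel k n (f : 'I_k -> 'I_n) (W : {set tri k}) :
  labels (relabel f @: W) = f @: labels W.
Proof. by rewrite /labels imsetU -!imset_comp. Qed.

Lemma ord_enumeration n (S : {set 'I_n}) a : #|S| = a ->
  exists2 f : 'I_a -> 'I_n, injective f & f @: setT = S.
Proof.
move=> <-; exists enum_val; first exact: enum_val_inj.
apply/setP => i; apply/imsetP/idP => [[j _ ->]|iS]; first exact: enum_valP.
by exists (enum_rank_in iS i); rewrite ?enum_rankK_in.
Qed.

(** Sets whose labels are exactly the image of [f] are the relabellings of sets on ['I_a] that use
    every label. *)
Lemma sum_labels n (F : {set tri n} -> R) (a : nat) (f : 'I_a -> 'I_n) : injective f ->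
  \sum_(W : {set tri n} | labels W == f @: setT) F W =
  \sum_(W : {set tri a} | labels W == setT) F (relabel f @: W).
Proof.
move=> inj; have rinj := @relabel_inj B _ _ _ inj.
rewrite (reindex_onto (fun W : {set tri a} => relabel f @: W)
  (fun W : {set tri n} => relabel f @^-1: W)) /=.
  apply: eq_bigl => W; rewrite preimset_imset // eqxx andbT labels_relabel.
  by rewrite (inj_eq (imset_inj inj)).
move=> W /eqP lW; apply: imset_preimset; apply/subsetP => t tW.
have [i _ ei] : exists2 i, i \in setT & t.2.1 = f i.
  by apply/imsetP; rewrite -lW in_setU [X in X || _](imset_f (fun u : tri n => u.2.1)).
have [j _ ej] : exists2 i, i \in setT & t.2.2 = f i.
  by apply/imsetP; rewrite -lW in_setU [X in _ || X](imset_f (fun u : tri n => u.2.2)) ?orbT.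
apply/codomP; exists (t.1, (i, j)); rewrite /relabel /= -ei -ej.
by case: t {ei ej tW} => ? [].
Qed.

Variable f : forall n, {set tri n} -> R.
Hypothesis f_relabel : forall k n (u : 'I_k -> 'I_n) (W : {set tri k}),
  injective u -> f (relabel u @: W) = f W.
Hypothesis f_sym : forall n (W : {set tri n}), f W != 0 -> symset W.

(** The sets are grouped by label set. All ['C(n, a)] label sets of size [a] contribute equally by
    invariance, which leaves finitely many shapes independent of [n]. *)
Lemma sum_by_labels M n :
  (forall W : {set tri n}, f W != 0 -> (#|labels W| <= M)%N) ->
  \sum_(W : {set tri n}) f W * prob_sub R W =
  \sum_(a < M.+1) 'C(n, a)%:R *
    \sum_(W : {set tri a} | labels W == setT) f W * prob_formula R W n.
Proof.
move=> fM; rewrite (bigID (fun W : {set tri n} => #|labels W| <= M)%N) /=.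
rewrite [X in _ + X]big1 ?addr0; last first.
  by move=> W lM; case: eqVneq (fM W) => [-> _|_ /(_ isT)]; rewrite ?mul0r // (negbTE lM).
rewrite (partition_big (@labels B n) (fun S => #|S| <= M)%N) //=.
rewrite (partition_big (fun S : {set 'I_n} => inord #|S| : 'I_M.+1) xpredT) //=.
apply: eq_bigr => a _.
transitivity (\sum_(S : {set 'I_n} | #|S| == a)
    \sum_(W : {set tri a} | labels W == setT) f W * prob_formula R W n).
  apply: eq_big => [S|S /andP[SM /eqP Sa]].
    apply/andP/eqP => [[SM /eqP <-]|->]; first by rewrite inordK.
    by rewrite inord_val -ltnS ltn_ord.
  have {}Sa : #|S| = a by rewrite -Sa inordK.
  have [u uinj uS] := ord_enumeration Sa.
  rewrite (eq_bigl (fun W => labels W == u @: setT)); last first.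
    by move=> W; rewrite uS; case: eqP => [->|]; rewrite ?SM ?andbF.
  rewrite sum_labels //; apply: eq_bigr => W _; rewrite f_relabel //.
  by have [->|/f_sym sW] := eqVneq (f W) 0; rewrite ?mul0r // prob_relabel.
rewrite sumr_const mulr_natl; congr (_ *+ _).
by rewrite -[n in 'C(n, _)]card_ord -card_draws; apply: eq_card => S; rewrite !inE.
Qed.

(** By symmetry each head index is also a tail index, so the labels are the second coordinates of
    the vertices. *)
Lemma labels_verts n (W : {set tri n}) : symset W -> (#|labels W| <= #|verts W|)%N.
Proof.
move=> /symsetP sW; apply: leq_trans (leq_imset_card snd (verts W)); apply: subset_leq_card.
apply/subsetP => i; rewrite inE => /orP[]/imsetP[t tW ->].
  exact: (imset_f snd (imset_f (@tail B n) tW)).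
exact: (imset_f snd (imset_f (@tail B n) (sW _ tW))).
Qed.

(** The bound [M] makes the number of shapes independent of [n]. Since [#|W|] is twice [sum d_e] and
    the number of labels is at most [#|verts W|], the order condition gives [q + a <= sum d_e], the
    exponent condition of [expands_binomial_ratio]. *)
Lemma expandable_invariant_sum M q r :
  (forall n (W : {set tri n}), f W != 0 ->
     (#|verts W| <= M)%N && ((q + #|verts W|).*2 <= #|W|)%N) ->
  expandable q r (fun n => \sum_(W : {set tri n}) f W * prob_sub R W).
Proof.
move=> H; apply: (expandable_ext (g := fun n => \sum_(a < M.+1) 'C(n, a)%:R *
    \sum_(W : {set tri a} | labels W == setT) f W * prob_formula R W n)).
  move=> n; rewrite -sum_by_labels // => W fW; have /andP[vM _] := H _ _ fW.
  exact: leq_trans (labels_verts (f_sym fW)) vM.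
apply: expandable_sum => a _.
apply: (expandable_ext (g := fun n => \sum_(W : {set tri a} | labels W == setT)
    f W * ('C(n, a)%:R * prob_formula R W n))).
  by move=> n; rewrite mulr_sumr; apply: eq_bigr => W _; rewrite mulrCA.
apply: expandable_sum => W /eqP lW; rewrite /prob_formula.
have [-> |fW] := eqVneq (f W) 0.
  by apply: expandable_ext (expandable0 q r) => n; rewrite mul0r.
apply: expandableZ; case: [forall e, _]; last first.
  by apply: expandable_ext (expandable0 q r) => n; rewrite mulr0.
apply: expands_binomial_ratio; have /andP[_] := H _ _ fW.
have sW := f_sym fW; rewrite (card_symset sW) leq_double; apply: leq_trans.
by rewrite leq_add2l -[X in (X <= _)%N]card_ord -cardsT -lW labels_verts.
Qed.

End InvariantSums.

(** * Embeddings into covers as placements of vertices *)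

Section Placement.
Variables (B : graph) (X : bgraph B) (n : nat).
Implicit Types x : {ffun gV (bg X) -> 'I_n}.

Definition place_vertex x (v : gV (bg X)) : gV B * 'I_n := (piV v, x v).
Definition place_dart x (d : gD (bg X)) : tri B n := (piD d, (x (tl d), x (hd d))).
(** Being over [B] fixes everything but the fibre indices of the vertices, so [x] alone encodes an
    embedding. *)
Definition placement x := injectiveb (place_vertex x) && injectiveb (place_dart x).

Lemma placementP x :
  reflect (injective (place_vertex x) /\ injective (place_dart x)) (placement x).
Proof. by apply: (iffP andP) => -[/injectiveP ? /injectiveP ?]. Qed.

Lemma tail_place x d : tail (place_dart x d) = place_vertex x (tl d).
Proof. by have [h _] := pi_morph X; rewrite /tail /place_vertex /= h. Qed.

Lemma trev_place x d : trev (place_dart x d) = place_dart x (inv d).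
Proof. by have [_ h] := pi_morph X; rewrite /trev /place_dart /= h /hd invK. Qed.

(** From an embedding, [x] is read off as the fibre coordinate of the vertex map. Conversely, a dart
    of the cover is determined by its base dart and tail index, and containment in [cover_darts s]
    makes the heads agree. *)
Lemma embeds_cover (s : cover_space B n) : embeds X (cover s) =
  [exists x, placement x && ([set place_dart x d | d : gD (bg X)] \subset cover_darts s)].
Proof.
have [mV mD] := pi_morph X.
apply/existsP/existsP => [[fV /existsP[fD]]|[x /andP[/placementP[injV injD] sub]]].
  case/and5P => /injectiveP injV /injectiveP injD /forallP hV /forallP hD.
  case/andP => /forallP pV /forallP pD.
  pose x := [ffun v => (fV v).2].
  have xD d : place_dart x d \in cover_darts s.
    have := congr1 snd (eqP (hV (inv d))); have := congr1 snd (eqP (hV d)).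
    rewrite inE /= !ffunE /hd => -> ->; rewrite (eqP (hD d)) /=.
    by rewrite /cover_inv /= -(eqP (pD d)).
  have fVE v : fV v = place_vertex x v.
    by rewrite /place_vertex ffunE -(eqP (pV v)); case: (fV v).
  exists x; apply/andP; split; last by apply/subsetP => _ /imsetP[d _ ->].
  apply/placementP; split; first by move=> u v; rewrite -!fVE => /injV.
  move=> d d' e; apply: injD; have [e1 e2 _] := e.
  have := eqP (hV d); have := eqP (hV d'); have := eqP (pD d); have := eqP (pD d').
  move: e1 e2; rewrite !ffunE => e1 e2 /= p1 p2 h1 h2.
  move: (congr1 snd h1) (congr1 snd h2) => /= h1' h2'.
  by apply/eqP; rewrite -pair_eqE /pair_eq /= -h1' -h2' p1 p2 e1 e2 !eqxx.
have xs d : val s (piD d) (x (tl d)) = x (hd d).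
  have /subsetP/(_ (place_dart x d)) := sub.
  by rewrite imset_f // => /(_ isT); rewrite inE => /eqP.
exists [ffun v => place_vertex x v]; apply/existsP.
exists [ffun d => (piD d, x (tl d))].
apply/and5P; split; last (apply/andP; split).
- by apply/injectiveP => u v; rewrite !ffunE => /injV.
- apply/injectiveP => d d'; rewrite !ffunE => -[e1 e2]; apply: injD.
  by rewrite /place_dart -!xs e1 e2.
- by apply/forallP => d; rewrite !ffunE /= /cover_tl /= -mV.
- by apply/forallP => d; rewrite !ffunE /= /cover_inv /= xs -mD.
- by apply/forallP => v; rewrite ffunE.
- by apply/forallP => d; rewrite ffunE.
Qed.

End Placement.

Lemma connect_crossing (T : finType) (e : rel T) (P : pred T) u v :
  connect e u v -> P u -> ~~ P v -> exists a b, [/\ e a b, P a & ~~ P b].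
Proof.
move=> /connectP[p + ->]; elim: p u => [|w p IH] u /=.
  by move=> _ Pu; rewrite Pu.
move=> /andP[euw pth] Pu nPl; have [Pw|nPw] := boolP (P w); first exact: IH Pw nPl.
by exists u, w.
Qed.

(** * Copies of elements of [Psi], their unions, and orders *)

Section Copies.
Variables (B : graph) (m : nat) (Psi : 'I_m -> bgraph B).
Hypothesis Psi_connected : forall i, connected (bg (Psi i)).
Hypothesis Psi_pruned : forall i, pruned (bg (Psi i)).
Hypothesis Psi_order : forall i, 1 <= graph_order (bg (Psi i)).

(** Only darts are recorded: in a pruned graph every vertex is a tail, so the vertices can be
    recovered. *)
Definition copy n (c : {set tri B n}) :=
  [exists i, [exists x : {ffun gV (bg (Psi i)) -> 'I_n},
     placement x && (c == [set place_dart x d | d : gD (bg (Psi i))])]].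

Lemma copyP n (c : {set tri B n}) :
  reflect (exists i (x : {ffun gV (bg (Psi i)) -> 'I_n}),
     placement x /\ c = [set place_dart x d | d : gD (bg (Psi i))]) (copy c).
Proof.
apply: (iffP existsP) => [[i /existsP[x /andP[px /eqP ->]]]|[i [x [px ->]]]].
  by exists i, x.
by exists i; apply/existsP; exists x; rewrite px eqxx.
Qed.

Definition has_copy n (A : {set tri B n}) := [exists c, copy c && (c \subset A)].

Lemma IPsi_has_copy n (s : cover_space B n) : IPsi Psi (cover s) = has_copy (cover_darts s).
Proof.
apply/existsP/existsP => [[i]|[c /andP[/copyP[i [x [px ->]]] sub]]].
  rewrite embeds_cover => /existsP[x /andP[px sub]].
  eexists; apply/andP; split; last exact: sub.
  by apply/copyP; exists i, x.
by exists i; rewrite embeds_cover; apply/existsP; exists x; rewrite px.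
Qed.

Lemma vertex_is_tail i (v : gV (bg (Psi i))) : exists d, v = tl d.
Proof.
have /forallP/(_ v) := Psi_pruned i; rewrite /degree => /ltnW/card_gt0P[d].
by rewrite inE => /eqP <-; exists d.
Qed.

Lemma copy_sym n (c : {set tri B n}) : copy c -> symset c.
Proof.
move=> /copyP[i [x [_ ->]]]; apply/symsetP => _ /imsetP[d _ ->].
by rewrite trev_place imset_f.
Qed.

Lemma copy_degree n (c : {set tri B n}) t : copy c -> t \in c ->
  (1 < #|[set u in c | tail u == tail t]|)%N.
Proof.
move=> /copyP[i [x [/placementP[_ injD] ->]]] /imsetP[d _ ->].
have /forallP/(_ (tl d)) := Psi_pruned i; rewrite /degree => /leq_trans; apply.
rewrite -(card_imset _ injD); apply: subset_leq_card.
apply/subsetP => _ /imsetP[d' + ->]; rewrite inE => /eqP e.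
by rewrite inE imset_f //= !tail_place e.
Qed.

Lemma copy_verts n i (x : {ffun gV (bg (Psi i)) -> 'I_n}) : placement x ->
  #|verts [set place_dart x d | d : gD (bg (Psi i))]| = #|gV (bg (Psi i))|.
Proof.
move=> /placementP[injV _]; rewrite -cardsT -(card_imset _ injV); apply: eq_card => v.
rewrite /verts -imset_comp; apply/imsetP/imsetP => [[d _ ->]|[w _ ->]].
  by exists (tl d); rewrite //= tail_place.
by have [d ->] := vertex_is_tail w; exists d; rewrite //= tail_place.
Qed.

Lemma copy_order n (c : {set tri B n}) : copy c -> ((1 + #|verts c|).*2 <= #|c|)%N.
Proof.
move=> /copyP[i [x [px ->]]]; rewrite copy_verts //.
have /placementP[_ injD] := px; rewrite card_imset //.
have := Psi_order i; rewrite /graph_order lerBrDr => h.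
apply: leq_trans (_ : (nedges (bg (Psi i))).*2 <= _)%N; first by rewrite leq_double; lia.
by rewrite /nedges -[leqRHS]odd_double_half leq_addl.
Qed.

Lemma copy_crossing n (c : {set tri B n}) (P : pred (gV B * 'I_n)) t u : copy c ->
  t \in c -> u \in c -> P (tail t) -> ~~ P (tail u) ->
  exists d, [/\ d \in c, P (tail d) & ~~ P (tail (trev d))].
Proof.
move=> /copyP[i [x [_ ->]]] /imsetP[a _ ->] /imsetP[b _ ->]; rewrite !tail_place => Pa Pb.
have /andP[_ /forallP/(_ (tl a))/forallP/(_ (tl b))] := Psi_connected i.
move=> /(connect_crossing (P := fun v => P (place_vertex x v)))/(_ Pa Pb).
case=> [v [w [/existsP[d /andP[/eqP dv /eqP dw]] Pv Pw]]].
exists (place_dart x d); rewrite imset_f // trev_place !tail_place.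
by rewrite -/(hd d) dv dw.
Qed.

Definition max_order := (\max_i #|gV (bg (Psi i))|)%N.

Lemma copy_verts_max n (c : {set tri B n}) : copy c -> (#|verts c| <= max_order)%N.
Proof.
move=> /copyP[i [x [px ->]]]; rewrite copy_verts //.
exact: (@leq_bigmax _ (fun i => #|gV (bg (Psi i))|)).
Qed.

(** Placements are composed with [f] in one direction. In the other, the indices of [x] lie in the
    image of [f] because every vertex is the tail of a relabelled dart. *)
Lemma copy_relabel k n (f : 'I_k -> 'I_n) (c : {set tri B k}) : injective f ->
  copy (relabel f @: c) = copy c.
Proof.
move=> inj; have rinj := @relabel_inj B _ _ _ inj.
apply/copyP/copyP => [[i [x [px e]]]|[i [x [/placementP[injV injD] ->]]]]; last first.
  exists i, [ffun v => f (x v)]; split.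
    apply/placementP; split=> [u v|d d']; rewrite /place_vertex /place_dart !ffunE.
      by case=> e1 /inj e2; apply: injV; rewrite /place_vertex e1 e2.
    by case=> e1 /inj e2 /inj e3; apply: injD; rewrite /place_dart e1 e2 e3.
  rewrite -imset_comp; apply: eq_imset => d.
  by rewrite /= /place_dart /relabel /= !ffunE.
have cod v : exists j, x v == f j.
  have [d ->] := vertex_is_tail v.
  have : place_dart x d \in relabel f @: c by rewrite e imset_f.
  by case/imsetP => t _ [_ -> _]; exists t.2.1.
have [y xy] : exists y, forall v, x v == f (y v) := fin_all_exists cod.
have xE d : place_dart x d = relabel f (place_dart [ffun v => y v] d).
  by rewrite /place_dart /relabel /= !ffunE -!(eqP (xy _)).
have /placementP[injV injD] := px.
exists i, [ffun v => y v]; split.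
  apply/placementP; split=> [u v|d d' dd]; last by apply: injD; rewrite !xE dd.
  by rewrite /place_vertex !ffunE => -[e1 e2]; apply: injV; rewrite /place_vertex !(eqP (xy _)) e1 e2.
apply: (imset_inj rinj); rewrite e -imset_comp; apply: eq_imset => d.
by rewrite xE.
Qed.

Lemma sub_relabel k n (f : 'I_k -> 'I_n) (A : {set tri B k}) (c : {set tri B n}) :
  c \subset relabel f @: A -> exists c' : {set tri B k}, c = relabel f @: c'.
Proof.
move=> sub; exists (relabel f @^-1: c); rewrite imset_preimset //.
exact: subset_trans sub (imset_sub_codom _ _).
Qed.

Lemma has_copy_relabel k n (f : 'I_k -> 'I_n) (A : {set tri B k}) : injective f ->
  has_copy (relabel f @: A) = has_copy A.
Proof.
move=> inj; have rinj := @relabel_inj B _ _ _ inj.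
apply/existsP/existsP => -[c /andP[cc sub]].
  have [c' e] := sub_relabel sub; exists c'.
  by rewrite e copy_relabel // imset_inj_sub // in cc sub *; rewrite cc.
by exists (relabel f @: c); rewrite copy_relabel // imset_inj_sub // cc.
Qed.

(** The unions of copies, the empty union included. *)
Definition good n (W : {set tri B n}) :=
  [forall t in W, [exists c, [&& copy c, c \subset W & t \in c]]].

Lemma goodP n (W : {set tri B n}) :
  reflect (forall t, t \in W -> exists c, [/\ copy c, c \subset W & t \in c]) (good W).
Proof.
apply: (iffP forall_inP) => H t /H; first by case/existsP => c /and3P[]; exists c.
by case=> c [cc sub tc]; apply/existsP; exists c; rewrite cc sub tc.
Qed.

Lemma good_relabel k n (f : 'I_k -> 'I_n) (W : {set tri B k}) : injective f ->
  good (relabel f @: W) = good W.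
Proof.
move=> inj; have rinj := @relabel_inj B _ _ _ inj.
apply/goodP/goodP => H t.
  rewrite -(mem_imset _ _ rinj) => /H[c [cc sub tc]].
  have [c' e] := sub_relabel sub; exists c'.
  by rewrite e copy_relabel // imset_inj_sub // mem_imset // in cc sub tc.
move=> /imsetP[u uW ->]; have [c [cc sub uc]] := H u uW.
by exists (relabel f @: c); rewrite copy_relabel // imset_inj_sub // mem_imset.
Qed.

Lemma card_verts_relabel k n (f : 'I_k -> 'I_n) (W : {set tri B k}) : injective f ->
  #|verts (relabel f @: W)| = #|verts W|.
Proof.
move=> inj; have inj2 : injective (fun v : gV B * 'I_k => (v.1, f v.2)).
  by move=> [v i] [w j] [-> /inj ->].
by rewrite -(card_imset (verts W) inj2) /verts -!imset_comp.
Qed.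

Lemma good_sym n (W : {set tri B n}) : good W -> symset W.
Proof.
move=> /goodP gW; apply/symsetP => t /gW[c [/copy_sym sc sub tc]].
by rewrite (subsetP sub) // symset_trev.
Qed.

Lemma good0 n : good (set0 : {set tri B n}).
Proof. by apply/goodP => t; rewrite inE. Qed.

Lemma copy_good n (c : {set tri B n}) : copy c -> good c.
Proof. by move=> cc; apply/goodP => t tc; exists c. Qed.

Lemma goodU n (U W : {set tri B n}) : good U -> good W -> good (U :|: W).
Proof.
move=> /goodP gU /goodP gW; apply/goodP => t /setUP[/gU|/gW] [c [cc sub tc]];
  by exists c; split=> //; apply: subset_trans sub _; rewrite ?subsetUl ?subsetUr.
Qed.

Lemma good_degree n (W : {set tri B n}) t : good W -> t \in W ->
  (1 < #|[set u in W | tail u == tail t]|)%N.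
Proof.
move=> /goodP gW /gW[c [cc sub tc]]; apply: leq_trans (copy_degree cc tc) _.
apply: subset_leq_card; apply/subsetP => u; rewrite !inE => /andP[uc ->].
by rewrite (subsetP sub).
Qed.

(** The darts are grouped by tail; each tail in a union of copies carries at least two of them. *)
Lemma card_new_darts n (U : {set tri B n}) (V : {set gV B * 'I_n}) : good U ->
  (#|verts U :\: V|.*2 <= #|[set u in U | tail u \notin V]|)%N.
Proof.
move=> gU; rewrite -[X in (_ <= X)%N]sum1_card.
rewrite (partition_big (@tail B n) (mem (verts U :\: V))) /=; last first.
  by move=> u; rewrite !inE => /andP[uU ->]; apply: imset_f.
rewrite -muln2 -sum_nat_const; apply: leq_sum => v; rewrite inE => /andP[vV /imsetP[t tU e]].
rewrite sum1_card; apply: leq_trans (good_degree gU tU) _.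
apply: subset_leq_card; apply/subsetP => u; rewrite !inE => /andP[uU /eqP eu].
by rewrite -topredE /= !inE uU eu -e vV eqxx.
Qed.

(** Order at least [q], with darts in place of edges and free of halving and subtraction. *)
Definition order_ge n q (W : {set tri B n}) := ((q + #|verts W|).*2 <= #|W|)%N.

Lemma order_ge_relabel k n (f : 'I_k -> 'I_n) q (W : {set tri B k}) : injective f ->
  order_ge q (relabel f @: W) = order_ge q W.
Proof.
move=> inj; rewrite /order_ge card_verts_relabel //.
by rewrite (card_imset W (@relabel_inj B _ _ _ inj)).
Qed.

(** Each vertex of [U] outside [verts W] brings at least two darts outside [W], that is one edge's
    worth, so the order cannot drop. *)
Lemma order_ge_sub n q (W U : {set tri B n}) : W \subset U -> good U ->
  order_ge q W -> order_ge q U.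
Proof.
rewrite /order_ge => WU gU oW.
have vS : verts W \subset verts U by apply: imsetS.
have new := card_new_darts (verts W) gU.
have newS : (#|[set u in U | tail u \notin verts W]| <= #|U :\: W|)%N.
  apply: subset_leq_card; apply/subsetP => u; rewrite !inE => /andP[-> uW].
  by rewrite andbT; apply: contra uW; apply: imset_f.
have arith (w u vw vu a : nat) : (w <= u -> vw <= vu -> (vu - vw).*2 <= a ->
    a <= u - w -> (q + vw).*2 <= w -> (q + vu).*2 <= u)%N by lia.
rewrite !cardsD (setIidPr WU) in newS; rewrite cardsD (setIidPr vS) in new.
exact: arith (subset_leq_card WU) (subset_leq_card vS) new newS oW.
Qed.

Lemma even_symset n (W : {set tri B n}) : symset W -> ~~ odd #|W|.
Proof. by move=> /card_symset ->; rewrite odd_double. Qed.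

(* Gluing a copy that is not already present raises the order: new vertices
   bring at least two darts each, and connectedness gives a dart leaving the old
   vertices unless the copy is disjoint, when its own order counts. *)
Lemma order_ge_addcopy n q (W c : {set tri B n}) : symset W -> copy c -> ~~ (c \subset W) ->
  order_ge q W -> order_ge q.+1 (W :|: c).
Proof.
move=> sW cc ncW oW.
suff key : ((1 + #|verts c :\: verts W|).*2 <= #|c :\: W|)%N.
  move: oW key; rewrite /order_ge /verts imsetU -/(verts _) -/(verts _).
  have := cardsUI W c; have := cardsID W c; rewrite setIC.
  have := cardsUI (verts W) (verts c); have := cardsID (verts W) (verts c).
  by rewrite [verts c :&: _]setIC; rewrite /verts; lia.
have new := card_new_darts (verts W) (copy_good cc).
set A := [set u in c | _] in new.
have AS : A \subset c :\: W.
  apply/subsetP => u; rewrite !inE => /andP[-> uW].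
  by rewrite andbT; apply: contra uW; apply: imset_f.
have [d|none] := pickP [pred d in c :\: W | tail d \in verts W].
  rewrite inE => /andP[dcW dV].
  have : (#|A| < #|c :\: W|)%N.
    apply: proper_card; rewrite properE AS; apply/subsetPn; exists d => //.
    by rewrite !inE dV andbF.
  (* The new darts exceed [#|A|], itself at least twice the number of new vertices. Their number is
     even, so the surplus is at least two. *)
  have := even_symset (symsetD (copy_sym cc) sW); lia.
have /subsetPn[t tc tW] := ncW.
have tV : tail t \notin verts W.
  by move: (none t); rewrite /= !inE tW tc /= => ->.
(* No new dart starts at an old vertex. If [c] met the old vertices, a dart leaving them would
   therefore lie in [W], and so would its reverse, making its head old. *)
have cV u : u \in c -> tail u \notin verts W.
  move=> uc; apply/negP => uV.
  have [d [dc dV dV']] := copy_crossing (P := mem (verts W)) cc uc tc uV tV.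
  have dW : d \in W by apply: contraFT (none d) => dW; rewrite /= !inE dW dc.
  by move: dV'; rewrite /= imset_f // symset_trev.
have -> : c :\: W = c.
  apply/setP => u; rewrite inE andbC; case uc: (u \in c) => //=.
  by apply: contra (cV u uc); apply: imset_f.
apply: leq_trans (copy_order cc); rewrite leq_double leq_add2l.
by apply: subset_leq_card; apply: subsetDl.
Qed.

(** Copies inside [W] are added greedily: each of [q] rounds raises the order by at least one and
    adds at most [max_order] vertices, unless [W] is already exhausted. *)
Lemma good_bounded n q (W : {set tri B n}) : good W -> exists W' : {set tri B n},
  [/\ W' \subset W, good W', (#|verts W'| <= q * max_order)%N & (W' == W) || order_ge q W'].
Proof.
move=> gW; elim: q => [|q [W' [sub gW' vW' h]]].
  exists set0; rewrite sub0set good0 /order_ge /verts imset0 !cards0 orbT; split=> //.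
have [e|ne] := eqVneq W' W.
  exists W'; split=> //; last by rewrite e eqxx.
  apply: leq_trans vW' _.
  by rewrite leq_mul2r leqnSn orbT.
rewrite (negbTE ne) /= in h.
have /subsetPn[t tW tW'] : ~~ (W \subset W').
  by apply: contra ne => s; rewrite eqEsubset sub.
have [c [cc csub tc]] := goodP _ gW t tW.
have ncW' : ~~ (c \subset W') by apply/subsetPn; exists t.
exists (W' :|: c); split.
- by rewrite subUset sub csub.
- exact: goodU gW' (copy_good cc).
- rewrite /verts imsetU mulSn addnC; apply: leq_trans (leq_card_setU _ _) _.
  by apply: leq_add vW' (copy_verts_max cc).
- by rewrite (order_ge_addcopy (good_sym gW') cc ncW' h) orbT.
Qed.

End Copies.

(** * Truncated inversion, its error, and the expansion of the mean *)

Section Truncation.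
Variables (R : realFieldType) (B : graph) (m : nat) (Psi : 'I_m -> bgraph B).
Hypothesis Psi_connected : forall i, connected (bg (Psi i)).
Hypothesis Psi_pruned : forall i, pruned (bg (Psi i)).
Hypothesis Psi_order : forall i, 1 <= graph_order (bg (Psi i)).
Variable r : nat.
Hypothesis r_gt0 : (0 < r)%N.

Notation L := (max_order Psi).

Definition copy_ind n (A : {set tri B n}) : R := (has_copy Psi A)%:R.

Definition small_coef n (W : {set tri B n}) : R :=
  if order_ge r W then 0 else moebius (@copy_ind n) W.

(** The weight [4 ^ #|W|] is the Moebius bound [2 ^ #|W|] times the number of subsets of [W]; the
    vertex bound is that of a union of two sets with at most [r * L] vertices each. *)
Definition large_coef n (W : {set tri B n}) : R :=
  if [&& good Psi W, order_ge r W & #|verts W| <= 2 * (r * L)]%N then 4 ^+ #|W| else 0.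

(** A dart of [W] lying in no copy inside [W] can be toggled in any subset of [W] without affecting
    [copy_ind]. *)
Lemma moebius_good n (W : {set tri B n}) : moebius (@copy_ind n) W != 0 -> good Psi W.
Proof.
apply: contraR => /forall_inPn[t tW /existsPn none].
have noc c : copy Psi c -> c \subset W -> t \notin c.
  by move=> cc cW; move: (none c); rewrite cc cW.
apply/eqP/(moebius_eq0 tW) => U UW; congr (_%:R); congr nat_of_bool.
apply/existsP/existsP => -[c /andP[cc sub]]; exists c; rewrite cc /=.
  by rewrite -(@toggle_super _ t) // noc //; apply: subset_trans sub _; rewrite sub_toggle.
by rewrite toggle_super // noc //; apply: subset_trans sub UW.
Qed.

Lemma copy_neq0 n (c : {set tri B n}) : copy Psi c -> c != set0.
Proof.
move=> /(copy_order Psi_pruned Psi_order); rewrite -card_gt0; apply: leq_trans.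
by rewrite double_gt0.
Qed.

Lemma moebius_set0 n : moebius (@copy_ind n) set0 = 0.
Proof.
rewrite /moebius big1 // => U; rewrite subset0 => /eqP ->.
rewrite /copy_ind (_ : has_copy _ _ = false) ?mulr0 //.
by apply/existsP => -[c]; rewrite subset0 => /andP[/copy_neq0/negbTE ->].
Qed.

Lemma small_coef_relabel k n (u : 'I_k -> 'I_n) (W : {set tri B k}) : injective u ->
  small_coef (relabel u @: W) = small_coef W.
Proof.
move=> inj; rewrite /small_coef order_ge_relabel //; case: ifP => // _.
by apply: moebius_imset (relabel_inj inj) _ => U; rewrite /copy_ind has_copy_relabel.
Qed.

Lemma large_coef_relabel k n (u : 'I_k -> 'I_n) (W : {set tri B k}) : injective u ->
  large_coef (relabel u @: W) = large_coef W.
Proof.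
move=> inj; rewrite /large_coef order_ge_relabel // good_relabel //.
by rewrite card_verts_relabel // (card_imset W (@relabel_inj B _ _ _ inj)).
Qed.

(** The empty set has coefficient zero, so [W] contains a copy and inherits its order of at least
    one. This makes the main expansion start at [1/n]. *)
Lemma small_coef_neq0 n (W : {set tri B n}) : small_coef W != 0 ->
  [/\ good Psi W, ~~ order_ge r W & order_ge 1 W].
Proof.
rewrite /small_coef; case: ifP => [|oW muW]; first by rewrite eqxx.
have gW := moebius_good muW; split=> //.
have [W0|[t tW]] := set_0Vmem W; first by rewrite W0 moebius_set0 eqxx in muW.
have [c [cc cW _]] := goodP _ _ gW t tW.
by apply: order_ge_sub cW gW _ => //; apply: (copy_order Psi_pruned Psi_order).
Qed.

(** The bounded subset given by [good_bounded] is [W] itself, as otherwise its order [r] would pass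
    to [W]. *)
Lemma small_verts n (W : {set tri B n}) : good Psi W -> ~~ order_ge r W ->
  (#|verts W| <= r * L)%N.
Proof.
move=> gW oW.
have [W' [sub gW' vW' /orP[/eqP <- //|oW']]] :=
  good_bounded Psi_connected Psi_pruned Psi_order r gW.
by rewrite (order_ge_sub Psi_pruned sub gW oW') in oW.
Qed.

Lemma large_coef_ge0 n (W : {set tri B n}) : 0 <= large_coef W.
Proof. by rewrite /large_coef; case: ifP => // _; rewrite exprn_ge0. Qed.

Lemma copy_ind_le1 n (A : {set tri B n}) : `|copy_ind A| <= 1.
Proof. by rewrite /copy_ind; case: has_copy; rewrite ?normr1 ?normr0 ?ler01. Qed.

(** The [1], which will bound [copy_ind], is absorbed by the empty set: it has coefficient zero on
    the left and weight [2^0] on the right, and [r > 0] keeps it among the small sets. *)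
Lemma sum_small_le n (A : {set tri B n}) :
  1 + \sum_(W : {set tri B n} | W \subset A) `|small_coef W| <=
  \sum_(W : {set tri B n} | [&& W \subset A, good Psi W & ~~ order_ge r W]) 2 ^+ #|W|.
Proof.
pose P := [pred W : {set tri B n} | [&& W \subset A, good Psi W & ~~ order_ge r W]].
have P0 : P set0.
  rewrite /= sub0set good0 /order_ge /verts imset0 !cards0 addn0 -ltnNge double_gt0.
  exact: r_gt0.
rewrite (bigID P) /= [X in _ + (_ + X)]big1 ?addr0; last first.
  move=> W /andP[WA nP]; apply/eqP; rewrite normr_eq0; apply: contraR nP.
  by case/small_coef_neq0 => -> -> _; rewrite WA.
rewrite (eq_bigl P) /=; last by move=> W; rewrite /= andbA andbb.
rewrite (bigD1 set0 P0) [leRHS](bigD1 set0 P0) /= cards0 expr0.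
have -> : small_coef (set0 : {set tri B n}) = 0.
  by rewrite /small_coef moebius_set0 if_same.
rewrite normr0 add0r lerD2l; apply: ler_sum => W _.
rewrite /small_coef; case: ifP => _; first by rewrite normr0 exprn_ge0.
exact/moebius_bound/copy_ind_le1.
Qed.

(* Joining a fixed set [W1] of large order to each small set gives sets counted
   by [large_coef]; a set [U] arises from at most [2 ^ #|U|] small sets. *)
Lemma sum_small_large n (A W1 : {set tri B n}) : W1 \subset A -> good Psi W1 ->
  order_ge r W1 -> (#|verts W1| <= r * L)%N ->
  \sum_(W : {set tri B n} | [&& W \subset A, good Psi W & ~~ order_ge r W]) 2 ^+ #|W| <=
  \sum_(U : {set tri B n} | U \subset A) large_coef U.
Proof.
move=> W1A gW1 oW1 vW1.
pose Q := [pred U : {set tri B n} | (U \subset A) &&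
  [&& good Psi U, order_ge r U & #|verts U| <= 2 * (r * L)]%N].
rewrite (partition_big (fun W => W :|: W1) Q) /=; last first.
  move=> W /and3P[WA gW oW]; rewrite subUset WA W1A goodU //=.
  rewrite (order_ge_sub Psi_pruned (subsetUr W W1) (goodU gW gW1) oW1) /=.
  rewrite /verts imsetU mul2n -addnn; apply: leq_trans (leq_card_setU _ _) _.
  exact: leq_add (small_verts gW oW) vW1.
rewrite [leRHS](bigID Q) /=; set rest := (X in _ <= _ + X).
have rest0 : 0 <= rest by apply: sumr_ge0 => U _; apply: large_coef_ge0.
apply: ler_wpDr rest0 _; rewrite [leRHS](eq_bigl Q) /=; last first.
  by move=> U /=; rewrite andbA andbb.
apply: ler_sum => U /andP[_ QU]; rewrite /large_coef QU.
apply: (@le_trans _ _ (\sum_(W : {set tri B n} | W \subset U) 2 ^+ #|U|)).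
  rewrite [leRHS](bigID (fun W : {set tri B n} =>
    [&& W \subset A, good Psi W & ~~ order_ge r W] && (W :|: W1 == U))) /=.
  apply: ler_wpDr; first by apply: sumr_ge0 => W _; rewrite exprn_ge0.
  rewrite [leRHS](eq_bigl (fun W : {set tri B n} =>
    [&& W \subset A, good Psi W & ~~ order_ge r W] && (W :|: W1 == U))).
    apply: ler_sum => W /andP[_ /eqP <-]; rewrite ler_weXn2l ?ler1n //.
    exact: subset_leq_card (subsetUl _ _).
  move=> W; rewrite andbC; apply: andb_idr => /andP[_ /eqP <-]; exact: subsetUl.
rewrite (eq_bigl (mem (powerset U))) => [|W]; last by rewrite /= inE.
rewrite sumr_const card_powerset.
rewrite -[X in _ <= X ^+ _](_ : 2 * 2 = 4 :> R); last by rewrite -natrM.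
by rewrite exprMn -[_ *+ (2 ^ _)]mulr_natr natrX.
Qed.

(** If [A] contains no union of copies of order at least [r], nothing is dropped and inversion is
    exact. Otherwise a bounded such union [W1] exists, and even the triangle inequality suffices. *)
Lemma truncation_error n (A : {set tri B n}) :
  `|copy_ind A - \sum_(W : {set tri B n} | W \subset A) small_coef W| <=
  \sum_(W : {set tri B n} | W \subset A) large_coef W.
Proof.
have [W0 /and3P[W0A gW0 oW0]|none] :=
    pickP [pred W : {set tri B n} | [&& W \subset A, good Psi W & order_ge r W]]; last first.
  rewrite -(moebius_inversion (@copy_ind n) A) -sumrB big1 ?normr0.
    by apply: sumr_ge0 => W _; apply: large_coef_ge0.
  move=> W WA; rewrite /small_coef; case: ifP => oW; rewrite ?subrr // subr0.
  apply/eqP; apply: contraFT (none W) => /moebius_good gW.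
  by rewrite /= WA gW oW.
have [W1 [sub gW1 vW1 h]] := good_bounded Psi_connected Psi_pruned Psi_order r gW0.
have oW1 : order_ge r W1 by case/orP: h => // /eqP ->.
apply: le_trans (sum_small_large (subset_trans sub W0A) gW1 oW1 vW1).
apply: le_trans (sum_small_le A); apply: le_trans (ler_normB _ _) _.
by apply: lerD (copy_ind_le1 A) (ler_norm_sum _ _ _).
Qed.

Lemma mean_sub_sum n (f : {set tri B n} -> R) :
  (\sum_(s : cover_space B n) \sum_(W : {set tri B n} | W \subset cover_darts s) f W) /
    #|{: cover_space B n}|%:R = \sum_(W : {set tri B n}) f W * prob_sub R W.
Proof.
rewrite (exchange_big_dep xpredT) //= mulr_suml; apply: eq_bigr => W _.
rewrite sumr_const -[f W *+ _]mulr_natr -mulrA; congr (_ * (_%:R / _)).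
by apply: eq_card => s; rewrite !inE.
Qed.

Lemma mean_truncation_error n :
  `|(\sum_(s : cover_space B n) copy_ind (cover_darts s)) / #|{: cover_space B n}|%:R -
    \sum_(W : {set tri B n}) small_coef W * prob_sub R W| <=
  \sum_(W : {set tri B n}) large_coef W * prob_sub R W.
Proof.
rewrite -!mean_sub_sum -mulrBl -sumrB normrM normfV normr_nat.
apply: ler_wpM2r; first by rewrite invr_ge0 ler0n.
by apply: le_trans (ler_norm_sum _ _ _) _; apply: ler_sum => s _; apply: truncation_error.
Qed.

Lemma mean_expansion : exists (p : nat -> R) (C : R) (N : nat), forall n, (N <= n)%N ->
  `|(\sum_(s : cover_space B n) copy_ind (cover_darts s)) / #|{: cover_space B n}|%:R -
    \sum_(1 <= k < r) p k / n%:R ^+ k| <= C / n%:R ^+ r.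
Proof.
have [||n|T1 e1] := @expandable_invariant_sum R B (@small_coef) _ _ (r * L) 1 r.
- exact: small_coef_relabel.
- by move=> n W /small_coef_neq0[gW _ _]; apply: good_sym gW.
- by move=> W /small_coef_neq0[gW oW oW1]; rewrite small_verts.
have large_neq0 n (W : {set tri B n}) : large_coef W != 0 ->
    [&& good Psi W, order_ge r W & #|verts W| <= 2 * (r * L)]%N.
  by rewrite /large_coef; case: ifP => //; rewrite eqxx.
(* Large sets have order at least [r], so their weighted count starts at exponent [r]. *)
have [||n|T2 e2] := @expandable_invariant_sum R B (@large_coef) _ _ (2 * (r * L)) r r.
- exact: large_coef_relabel.
- by move=> n W /large_neq0/and3P[gW _ _]; apply: good_sym gW.
- by move=> W /large_neq0/and3P[_ oW vW]; rewrite vW.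
have [p [C1 [N1 b1]]] := expands_truncate e1.
have [p2 [C2 [N2 b2]]] := expands_truncate e2.
exists p, (C1 + C2), (maxn N1 N2) => n; rewrite geq_max => /andP[n1 n2].
(* For the large part the sum from [r] to [r] is empty, leaving a bound [C2 / n^r]. *)
have := b1 n n1; have := b2 n n2; rewrite big_geq // subr0 => large small.
have err := le_trans (mean_truncation_error n) (le_trans (ler_norm _) large).
rewrite -(subrKA (\sum_(W : {set tri B n}) small_coef W * prob_sub R W)) mulrDl.
by rewrite [leRHS]addrC; apply: le_trans (ler_normD _ _) (lerD err small).
Qed.

End Truncation.

Theorem theorem2p80 (R : realType) (B : graph) (m : nat) (Psi : 'I_m -> bgraph B) :
  connected B -> 0 < graph_order B ->
  (forall i : 'I_m, [&& connected (bg (Psi i)), pruned (bg (Psi i)) & 1 <= graph_order (bg (Psi i))]) ->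
  forall r : nat, (0 < r)%N ->
  exists (p : nat -> R) (C : R) (N : nat),
    forall n : nat, (N <= n)%N ->
      `| @expect_IPsi R B m Psi n - \sum_(1 <= k < r) p k / n%:R ^+ k | <= C / n%:R ^+ r.
Proof.
move=> _ _ H r r_gt0.
have Hc i : connected (bg (Psi i)) by case/and3P: (H i).
have Hp i : pruned (bg (Psi i)) by case/and3P: (H i).
have Ho i : 1 <= graph_order (bg (Psi i)) by case/and3P: (H i).
have [p [C [N b]]] := mean_expansion R Hc Hp Ho r_gt0.
exists p, C, N => n nN; rewrite /expect_IPsi.
rewrite (eq_bigr (fun s => copy_ind R Psi (cover_darts s))); first exact: b.
by move=> s _; rewrite IPsi_has_copy.
Qed.
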